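(* Let $n\in\mathbb{N}$ and $\mathbf{y}\in\mathbb{N}^n$. Then $\mathsf{PA}^{\mathrm{inv},\uparrow}_n(\mathbf{y})\subseteq\{1\}^{n-\chi(\mathbf{y})}\times\mathcal{W}(\mathbf{y})^{\chi(\mathbf{y})}$. In particular, $$|\mathsf{PA}^{\mathrm{inv},\uparrow}_n(\mathbf{y})|\le\binom{2^{n-1}+n-2}{n-1}.$$
   Context: $\mathbb{N}=\{1,2,3,\dots\}$ and $[n]=\{1,\dots,n\}$. Let $\mathbf{y}=(y_1,\dots,y_n)\in\mathbb{N}^n$ and $m=\sum_{i=1}^n y_i$. Consider a one-way street with $m$ parking spots numbered $1,\dots,m$ and $n$ cars entering in order $1,2,\dots,n$, where car $i$ has length $y_i$ and prefers spot $x_i\in[m]$. Car $i$ drives to spot $x_i$ and parks in $x_i,x_i+1,\dots,x_i+y_i-1$ if these spots exist and are all unoccupied; otherwise it parks in the next $y_i$ contiguous available spots, i.e. it occupies $s,s+1,\dots,s+y_i-1$ for the smallest $s\ge x_i$ such that $s+y_i-1\le m$ and all these spots are unoccupied; if no such $s$ exists, parking fails. The vector $\mathbf{x}=(x_1,\dots,x_n)\in[m]^n$ is a parking assortment for $\mathbf{y}$ if all cars can park; the set of these is $\mathsf{PA}_n(\mathbf{y})$. A parking assortment $\mathbf{x}$ is (permutation) invariant if every permutation of its entries is also in $\mathsf{PA}_n(\mathbf{y})$; $\mathsf{PA}^{\mathrm{inv}}_n(\mathbf{y})$ is the set of invariant parking assortments for $\mathbf{y}$, and $\mathsf{PA}^{\mathrm{inv},\uparrow}_n(\mathbf{y})\subseteq\mathsf{PA}^{\mathrm{inv}}_n(\mathbf{y})$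 is its subset of nondecreasing elements. For $\mathbf{x}\in\mathsf{PA}^{\mathrm{inv}}_n(\mathbf{y})$ the degree is $\deg\mathbf{x}=|\{i\in[n]:x_i\ne 1\}|$, and the characteristic of $\mathbf{y}$ is $\chi(\mathbf{y})=\max_{\mathbf{z}\in\mathsf{PA}^{\mathrm{inv}}_n(\mathbf{y})}\deg\mathbf{z}$. The invariant solution set of $\mathbf{y}$ is $\mathcal{W}(\mathbf{y})=\{w\in\mathbb{N}:(1^{n-1},w)\in\mathsf{PA}^{\mathrm{inv}}_n(\mathbf{y})\}$, where $(1^{n-1},w)$ is the vector $(1,\dots,1,w)$ with $n-1$ leading ones. *)

(* Defs.v *)
From mathcomp Require Import all_boot.

Set Implicit Arguments.
Unset Strict Implicit.
Unset Printing Implicit Defensive.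

(* The vectors x and y are sequences of naturals; the number of cars is
   size y, and the spots are numbered 1, ..., sumn y. *)

(* occ is the list of occupied spots, m is the number of the last spot. *)
Definition free_block (m : nat) (occ : seq nat) (s l : nat) : bool :=
  (s + l <= m.+1) && all [pred k | k \notin occ] (iota s l).

(* Least s in p, ..., m such that s, ..., s + l - 1 exist and are free. The car
   parks there in both cases of the parking rule: s = p when the preferred
   block is free, and otherwise s is the start of the next free block. *)
Definition parking_start (m : nat) (occ : seq nat) (p l : nat) : option nat :=
  ohead [seq s <- iota p (m.+1 - p) | free_block m occ s l].

(* Each car is a pair (preferred spot, length). *)
Fixpoint all_park (m : nat) (occ : seq nat) (cars : seq (nat * nat)) : bool :=
  if cars is (p, l) :: cars' then
    if parking_start m occ p l is Some s
    then all_park m (iota s l ++ occ) cars'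
    else false
  else true.

Definition PA (y : seq nat) : pred (seq nat) :=
  [pred x | [&& size x == size y,
                all [pred p | 1 <= p <= sumn y] x
              & all_park (sumn y) [::] (zip x y)]].

Definition PAinv (y : seq nat) : pred (seq nat) :=
  [pred x | (x \in PA y) && all [pred x' | x' \in PA y] (permutations x)].

Definition PAinv_up (y : seq nat) : pred (seq nat) :=
  [pred x | (x \in PAinv y) && sorted leq x].

Definition deg (x : seq nat) : nat := count [pred a | a != 1] x.

(* A finite type of vectors, with entries in 0, ..., m, used only for maxima
   and cardinals: every element of PA y is vec_val v for exactly one v. *)
Definition vec (y : seq nat) : finType := (size y).-tuple 'I_(sumn y).+1.

Definition vec_val (y : seq nat) (v : vec y) : seq nat :=
  [seq val i | i <- tval v].

Definition chi (y : seq nat) : nat :=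
  \max_(z : vec y | vec_val z \in PAinv y) deg (vec_val z).

Definition PAinv_up_set (y : seq nat) : {set vec y} :=
  [set v : vec y | vec_val v \in PAinv_up y].

(* The condition w >= 1 is part of membership in PA y. *)
Definition W (y : seq nat) : pred nat :=
  [pred w | rcons (nseq (size y).-1 1) w \in PAinv y].

(* Main.v *)
(* In an invariant assortment the smallest entry other than 1 may be replaced by
   1, and the largest entry may be dropped together with the last car: preferring
   the maximum, that car must park at the very end. Conversely a last car may
   always be appended to an assortment that fills the street. Hence every entry
   of an invariant assortment is in W. If the first car prefers w and the others
   prefer 1, the gap before w is filled by whole cars, so w - 1 is a subset sum of
   the other lengths and W has at most 2^(n-1) elements; a nondecreasing
   invariant assortment is 1 followed by a sorted (n-1)-tuple over W. *)

Require Import Defs.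
From mathcomp Require Import all_boot.
From mathcomp Require Import zify.

Set Implicit Arguments.
Unset Strict Implicit.
Unset Printing Implicit Defensive.

(** * Parking a single car *)

Lemma free_blockP m occ s l :
  reflect (s + l <= m.+1 /\ forall k, s <= k < s + l -> k \notin occ)
          (free_block m occ s l).
Proof.
apply: (iffP andP) => -[sl_m free]; split=> //.
  by move=> k; rewrite -mem_iota => /(allP free).
by apply/allP=> k; rewrite mem_iota; apply: free.
Qed.

Lemma ohead_filter_iotaP (P : pred nat) p k s :
  ohead [seq t <- iota p k | P t] = Some s <->
  [/\ p <= s < p + k, P s & forall t, p <= t < s -> ~~ P t].
Proof.
elim: k p => [|k IH] p /=; first by split=> // -[]; lia.
case: ifP => Pp /=.
  split=> [[<-]|[ps Ps Pt]]; first by split=> //; lia.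
  suff -> : p = s by [].
  by apply: contraTeq Pp => /eqP p_s; apply: Pt; lia.
rewrite IH; split=> -[ps Ps Pt]; split=> //; first by lia.
- by move=> t pt; have [->|tp] := eqVneq t p; [rewrite Pp | apply: Pt; lia].
- by have : s != p by [apply: contraTneq Ps => ->; rewrite Pp]; lia.
- by move=> t pt; apply: Pt; lia.
Qed.

Lemma parking_startP m occ p l s :
  parking_start m occ p l = Some s <->
  [/\ p <= s <= m, free_block m occ s l
    & forall t, p <= t < s -> ~~ free_block m occ t l].
Proof.
by rewrite ohead_filter_iotaP; split=> -[ps Ps Pt]; split=> //; lia.
Qed.

(** A block starting at [t < s] ends before the one at [s], so the end of the shorter street
    excluded no earlier candidate. *)
Lemma parking_startW m m' occ p l s : m <= m' ->
  parking_start m occ p l = Some s -> parking_start m' occ p l = Some s.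
Proof.
move=> mm' /parking_startP[ps /free_blockP[sl_m free] Pt].
apply/parking_startP; split=> [||t pt]; first by lia.
  by apply/free_blockP; split=> //; lia.
apply: contra (Pt t pt) => /free_blockP[_ free_t].
by apply/free_blockP; split=> //; lia.
Qed.

Lemma parking_start_shrink m m' occ p l s : m <= m' -> 0 < l ->
  s + l <= m.+1 ->
  parking_start m' occ p l = Some s -> parking_start m occ p l = Some s.
Proof.
move=> mm' l0 slm /parking_startP[ps /free_blockP[sl_m free] Pt].
apply/parking_startP; split=> [||t pt]; first by lia.
  by apply/free_blockP; split.
apply: contra (Pt t pt) => /free_blockP[tl free_t].
by apply/free_blockP; split=> //; lia.
Qed.

Lemma parking_start_exists m occ p l s :
  p <= s <= m -> free_block m occ s l -> parking_start m occ p l.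
Proof.
move=> ps free; rewrite /parking_start.
case E: (filter _ _) => [|//].
suff: s \in [seq t <- iota p (m.+1 - p) | free_block m occ t l] by rewrite E.
by rewrite mem_filter free mem_iota; lia.
Qed.

(** * Occupied spots after a run of cars *)

(** [all_park] reports success only; the counting arguments need the list of occupied spots. *)
Fixpoint final_spots (m : nat) (occ : seq nat) (cars : seq (nat * nat)) :
    option (seq nat) :=
  if cars is (p, l) :: cars' then
    if parking_start m occ p l is Some s
    then final_spots m (iota s l ++ occ) cars'
    else None
  else Some occ.

Lemma all_parkE m occ cars : all_park m occ cars = final_spots m occ cars.
Proof.
elim: cars occ => //= -[p l] cars IH occ.
by case: parking_start => // s; apply: IH.
Qed.

Lemma final_spots_cat m occ c1 c2 :
  final_spots m occ (c1 ++ c2) =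
  obind (fun occ1 => final_spots m occ1 c2) (final_spots m occ c1).
Proof.
elim: c1 occ => //= -[p l] c1 IH occ.
by case: parking_start => // s; apply: IH.
Qed.

Lemma final_spotsW m m' occ cars occ' : m <= m' ->
  final_spots m occ cars = Some occ' -> final_spots m' occ cars = Some occ'.
Proof.
move=> mm'; elim: cars occ => //= -[p l] cars IH occ.
by case E: parking_start => [s|//]; rewrite (parking_startW mm' E); apply: IH.
Qed.

Lemma final_spots_sub m occ cars occ' :
  final_spots m occ cars = Some occ' -> {subset occ <= occ'}.
Proof.
elim: cars occ => /= [|[p l] cars IH] occ; first by case=> ->.
by case: parking_start => // s /IH sub q q_occ; apply: sub; rewrite mem_cat q_occ orbT.
Qed.

Lemma final_spots_shrink m m' occ cars occ' : m <= m' ->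
  all [pred c | 0 < c.2] cars -> all (leq^~ m) occ' ->
  final_spots m' occ cars = Some occ' -> final_spots m occ cars = Some occ'.
Proof.
move=> mm' + occ'm; elim: cars occ => //= -[p l] cars IH occ /andP[/= l0 cars0].
case E: parking_start => [s|//] run.
rewrite (parking_start_shrink mm' l0 _ E) ?IH //.
(* [s + l.-1] is the last spot of the new block; it stays occupied, so it is at most [m]. *)
have /(allP occ'm) /= : s + l.-1 \in occ'; last by lia.
by apply: (final_spots_sub run); rewrite mem_cat mem_iota; lia.
Qed.

(** Cars never drive backwards. Hence a newly filled spot forces some small preference. *)
Lemma final_spots_bounds m occ cars occ' q :
  final_spots m occ cars = Some occ' -> q \in occ' -> q \notin occ ->
  q <= m /\ exists2 p, p \in unzip1 cars & p <= q.
Proof.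
elim: cars occ => /= [|[p l] cars IH] occ; first by case=> -> ->.
case E: parking_start => [s|//] run q_occ' q_occ.
have [|q_new] := boolP (q \in iota s l ++ occ).
  have [ps /free_blockP[sl _] _] := (parking_startP _ _ _ _ _).1 E.
  rewrite mem_cat (negPf q_occ) orbF mem_iota => sq.
  by split; [lia | exists p; rewrite ?mem_head //=; lia].
have [qm [p' p'_cars p'q]] := IH _ run q_occ' q_new.
by split=> //; exists p'; rewrite // inE p'_cars orbT.
Qed.

Lemma final_spots_uniq m occ cars occ' :
  final_spots m occ cars = Some occ' -> uniq occ ->
  uniq occ' /\ size occ' = size occ + sumn (unzip2 cars).
Proof.
elim: cars occ => /= [|[p l] cars IH] occ; first by case=> ->; rewrite addn0.
case E: parking_start => [s|//] run u.
have [ps /free_blockP[sl free] _] := (parking_startP _ _ _ _ _).1 E.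
have [|-> ->] := IH _ run.
  rewrite cat_uniq iota_uniq u andbT /=.
  by apply/hasPn => q q_occ; rewrite mem_iota; apply: contraL q_occ; apply: free.
by rewrite size_cat size_iota addnAC addnC.
Qed.

(** Pigeonhole: there are [sumn y] distinct occupied spots, all between [1] and [sumn y]. *)
Lemma final_spots_full x y occ : size x = size y -> all (leq 1) x ->
  final_spots (sumn y) [::] (zip x y) = Some occ ->
  forall q, (q \in occ) = (1 <= q <= sumn y).
Proof.
move=> sxy x1 run q.
have [//|u sz] := final_spots_uniq run.
rewrite unzip2_zip ?sxy //= add0n in sz.
have sub : {subset occ <= iota 1 (sumn y)}.
  move=> k /(final_spots_bounds run) /(_ isT)[km [p]].
  rewrite unzip1_zip ?sxy // => /(allP x1) /= p1 pk.
  by rewrite mem_iota; lia.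
have [|_ ->] := uniq_min_size u sub; first by rewrite size_iota sz.
by rewrite mem_iota add1n ltnS.
Qed.

(** A car parking at [s > M] could not start at [s.-1], and only spot [s.-1] itself can be the
    obstacle; so no gap opens from [M] on. *)
Lemma final_spots_contiguous m cars occ' M :
  all (leq^~ M) (unzip1 cars) ->
  final_spots m [::] cars = Some occ' ->
  forall q t, q \in occ' -> M <= t <= q -> t \in occ'.
Proof.
move=> cM.
(* The property of the empty street becomes the induction invariant for arbitrary [occ]. *)
have: forall q t, q \in [::] -> M <= t <= q -> t \in [::] by [].
move: [::] => occ; elim: cars occ cM => /= [|[p l] cars IH] occ.
  by move=> _ contig [<-].
case/andP=> /= pM cM contig; case E: parking_start => [s|//].
have [ps /free_blockP[sl free] noblock] := (parking_startP _ _ _ _ _).1 E.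
apply: IH => // q t; rewrite !mem_cat !mem_iota.
case/orP=> [sq tq|q_occ tq]; last by rewrite (contig q) ?orbT.
have [//|/= t_s] := boolP (s <= t < s + l).
have Ms : M < s by lia.
have /noblock : p <= s.-1 < s by lia.
apply: contraR => t_occ; apply/free_blockP; split; first by lia.
move=> k ks; have [sk|] := leqP s k; first by apply: free; lia.
by move=> kls; apply: contra t_occ => /contig; apply; lia.
Qed.

Lemma final_spots_pref m occ cars occ' :
  final_spots m occ cars = Some occ' -> {in unzip1 cars, forall p, p <= m}.
Proof.
elim: cars occ => //= -[q l] cars IH occ.
case E: parking_start => [s|//] run p; rewrite inE => /predU1P[->|]; last exact: IH run p.
by have [/andP[/= qs sm] _ _] := (parking_startP _ _ _ _ _).1 E; apply: leq_trans sm.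
Qed.

(** * Membership in [PA] and [PAinv] *)

Lemma PAP y x : reflect
  [/\ size x = size y, all (leq 1) x
    & exists occ, final_spots (sumn y) [::] (zip x y) = Some occ]
  (x \in PA y).
Proof.
rewrite inE all_parkE; apply: (iffP and3P) => -[/eqP sxy].
  move=> x1; case E: final_spots => [occ|//] _.
  by split=> //; [apply: sub_all x1 => p /andP[] | exists occ].
move=> x1 [occ run]; split; rewrite ?run //.
apply/allP => p px; rewrite /= (allP x1) //=.
by apply: (final_spots_pref run); rewrite unzip1_zip ?(eqP sxy).
Qed.

Lemma PAinvP y x :
  reflect (forall x', perm_eq x' x -> x' \in PA y) (x \in PAinv y).
Proof.
rewrite inE; apply: (iffP andP) => [[_ /allP all_x] x' xx'|all_x].
  by apply: all_x; rewrite mem_permutations.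
by split; [apply: all_x | apply/allP=> x'; rewrite mem_permutations => /all_x].
Qed.

Lemma PAinv_perm y x x' : perm_eq x x' -> (x \in PAinv y) = (x' \in PAinv y).
Proof.
move=> xx'; apply/PAinvP/PAinvP => P z zx; apply: P; apply: perm_trans zx _ => //.
by rewrite perm_sym.
Qed.

(** * From invariant assortments to [W] *)

Lemma split_last_occ (T : eqType) (a : T) s :
  a \in s -> exists u v, s = u ++ a :: v /\ a \notin v.
Proof.
elim: s => //= b s IH; rewrite inE => as_.
have [/IH[u [v [-> av]]]|a_s] := boolP (a \in s); first by exists (b :: u), v.
by move: as_; rewrite (negPf a_s) orbF => /eqP <-; exists [::], s.
Qed.

(* Put [a] where an arrangement with the extra [1] has its last [1]: later cars
   all prefer spots from [a] on, so spots [1, ..., a - 1] are already full when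
   that car arrives, and it parks in the same place with either preference. *)
Lemma PAinv_lower_min y k a s : all (leq 1) y -> all (leq a) s ->
  nseq k 1 ++ a :: s \in PAinv y -> nseq k.+1 1 ++ s \in PAinv y.
Proof.
move=> y1 as_ inv; apply/PAinvP => x' x'p.
have [u [v [x'E v1]]] : exists u v, x' = u ++ 1 :: v /\ 1 \notin v.
  by apply: split_last_occ; rewrite (perm_mem x'p).
have uvp : perm_eq (u ++ v) (nseq k 1 ++ s).
  by rewrite -(perm_cons 1); apply: perm_trans x'p; rewrite x'E perm_sym -cat1s perm_catCA.
have av : all (leq a) v.
  apply/allP=> p pv; have : p \in nseq k 1 ++ s.
    by rewrite -(perm_mem uvp) mem_cat pv orbT.
  rewrite mem_cat mem_nseq => /orP[/andP[_ /eqP p1]|/(allP as_)//].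
  by rewrite p1 (negPf v1) in pv.
have /(PAinvP _ _ inv)/PAP[szx x1 [occ run]] :
    perm_eq (u ++ a :: v) (nseq k 1 ++ a :: s).
  by rewrite -[a :: v]cat1s -[a :: s]cat1s perm_catCA perm_sym perm_catCA perm_cat2l perm_sym.
have full := final_spots_full szx x1 run.
have [y2 [l [y3 [yE szu]]]] :
    exists y2 l y3, y = y2 ++ l :: y3 /\ size u = size y2.
  have su : size u < size y by rewrite -szx size_cat /=; lia.
  exists (take (size u) y), (nth 0 y (size u)), (drop (size u).+1 y).
  by rewrite -drop_nth // cat_take_drop size_takel // ltnW.
have l0 : 0 < l by apply: (allP y1); rewrite yE mem_cat mem_head orbT.
have a0 : 0 < a by apply: (allP x1); rewrite mem_cat mem_head orbT.
apply/PAP; split.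
- by rewrite x'E -szx !size_cat.
- by move: x1; rewrite x'E !all_cat /= => /and3P[-> _ ->].
have zipE b : zip (u ++ b :: v) y = zip u y2 ++ (b, l) :: zip v y3.
  by rewrite yE zip_cat.
exists occ; move: run full; rewrite x'E !zipE !final_spots_cat.
case: (final_spots _ _ (zip u y2)) => //= occ1.
case E: parking_start => [t|//] run full.
have [ta ft noblock] := (parking_startP _ _ _ _ _).1 E.
suff -> : parking_start (sumn y) occ1 1 l = Some t by [].
apply/parking_startP; split=> // [|r r1]; first by lia.
have [ra|] := leqP a r; first by apply: noblock; lia.
move=> ra; have {run} r_occ1 : r \in occ1; last first.
  by apply/negP=> /free_blockP[_ /(_ r)]; rewrite r_occ1 => /(_ _)/negP[] //; lia.
have r_occ : r \in occ by rewrite full; lia.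
apply: contraLR r_occ => r_occ1; apply/negP => r_occ.
case: (boolP (r \in iota t l ++ occ1)); first by rewrite mem_cat (negPf r_occ1) mem_iota; lia.
case/(final_spots_bounds run r_occ) => _ [p].
rewrite unzip1_zip; first by move/(allP av) => /=; lia.
by move: szx; rewrite yE !size_cat szu /=; lia.
Qed.

(** Iterates [PAinv_lower_min] on the head of the sorted list, its smallest entry, until only the
    largest entry [w] keeps its value. *)
Lemma PAinv_lower_last y k s w : all (leq 1) y -> sorted leq (rcons s w) ->
  nseq k 1 ++ rcons s w \in PAinv y ->
  nseq (k + size s) 1 ++ [:: w] \in PAinv y.
Proof.
move=> y1; elim: s k => [|a s IH] k /=; first by rewrite addn0.
move=> srt inv; rewrite -addSnnS; apply: IH; first exact: path_sorted srt.
by apply: PAinv_lower_min inv => //; apply: order_path_min srt; exact: leq_trans.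
Qed.

(** Let the entry [M] come last. The earlier cars leave no gap from [M] on, so the last car parks
    beyond all of them; as the street ends full, it takes the final [l] spots and the others fit
    into [sumn y]. *)
Lemma PAinv_truncate y l x M : all (leq 1) (rcons y l) -> all (leq^~ M) x ->
  rcons x M \in PAinv (rcons y l) -> x \in PAinv y.
Proof.
rewrite all_rcons => /andP[/= l0 y1] xM inv; apply/PAinvP => x' x'p.
have /(PAinvP _ _ inv)/PAP[szx x1 [occ run]] : perm_eq (rcons x' M) (rcons x M).
  by rewrite perm_rcons perm_sym perm_rcons perm_sym perm_cons.
have full := final_spots_full szx x1 run.
have {}szx : size x' = size y by move: szx; rewrite !size_rcons => -[].
move: x1; rewrite all_rcons => /andP[/= M1 x1].
apply/PAP; split=> //; move: run full; rewrite sumn_rcons zip_rcons // -cats1 final_spots_cat.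
case E1: (final_spots _ _ (zip x' y)) => [occ1|//] /=.
case E: parking_start => [s|//] [<-] full.
have [Ms /free_blockP[sl free] noblock] := (parking_startP _ _ _ _ _).1 E.
(* By contiguity from [M], an occupied [q >= s] would make [s] occupied too. *)
have occ1s : {in occ1, forall q, q < s}.
  move=> q q_occ; rewrite ltnNge; apply/negP => sq.
  have /negP[] : s \notin occ1 by apply: free; lia.
  apply: (final_spots_contiguous _ E1 q_occ (M := M)); last by lia.
  by rewrite unzip1_zip ?szx // (perm_all _ x'p).
exists occ1; apply: final_spots_shrink E1; first exact: leq_addr.
  apply/allP => -[p r] /(map_f snd) /=; rewrite -/(unzip2 _) unzip2_zip ?szx //.
  exact: (allP y1).
apply/allP => q /occ1s qs /=.
(* The last spot lies in the last car's block, which forces [s = (sumn y).+1]. *)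
have : sumn y + l \in iota s l ++ occ1 by rewrite full; lia.
by rewrite mem_cat mem_iota => /orP[|/occ1s]; lia.
Qed.

(** The earlier cars fill exactly [1, ..., sumn y], so the block starting at [(sumn y).+1] is free
    and not before [b]. *)
Lemma PA_rcons y l x b : 0 < l -> 0 < b <= (sumn y).+1 ->
  x \in PA y -> rcons x b \in PA (rcons y l).
Proof.
move=> l0 b1 /PAP[szx x1 [occ run]].
have full := final_spots_full szx x1 run.
apply/PAP; split; rewrite ?size_rcons ?szx ?all_rcons ?x1 ?andbT //=.
  by case/andP: b1.
rewrite sumn_rcons zip_rcons // -cats1 final_spots_cat.
rewrite (final_spotsW _ run) ?leq_addr //=.
have : parking_start (sumn y + l) occ b l.
  apply: (parking_start_exists (s := (sumn y).+1)); first by lia.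
  by apply/free_blockP; split=> [|k]; rewrite ?full; lia.
by case: parking_start => // s _; exists (iota s l ++ occ).
Qed.

(** Induction removing the last car. The maximum [M] is handled by lowering all other entries; any
    other entry survives dropping [M], and the last car is then appended again. *)
Lemma mem_W y x w : all (leq 1) y -> x \in PAinv y -> w \in x -> w \in W y.
Proof.
elim/last_ind: y x => [|y l IH] x y1 inv wx.
  by have /PAP[/size0nil x0] := PAinvP _ _ inv _ (perm_refl x); rewrite x0 in wx.
have [l0 y1'] : 0 < l /\ all (leq 1) y by move: y1; rewrite all_rcons => /andP.
have psort : perm_eq x (sort leq x) by rewrite perm_sym perm_sort.
rewrite (PAinv_perm _ psort) in inv; rewrite (perm_mem psort) in wx.
have := sort_sorted leq_total x.
case/lastP: (sort leq x) inv wx => // s M inv wx srt.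
have szs : size s = size y.
  by have /PAP[] := PAinvP _ _ inv _ (perm_refl _); rewrite !size_rcons => -[].
have lowM := PAinv_lower_last (k := 0) y1 srt inv.
rewrite /W inE size_rcons /=.
move: wx; rewrite mem_rcons inE => /predU1P[->|ws].
  by rewrite -szs -cats1.
have sM : all (leq^~ M) s.
  have : sorted geq (rev (rcons s M)) by rewrite rev_sorted.
  rewrite rev_rcons /= => /(order_path_min (rev_trans leq_trans)).
  by rewrite all_rev.
have wW := IH _ y1' (PAinv_truncate y1 sM inv) ws.
rewrite /W inE in wW.
have sz0 : size y = (size y).-1.+1.
  by rewrite prednK // -szs; case: (s) ws.
have w1 : 0 < w <= sumn y.
  have := PAinvP _ _ wW _ (perm_refl _); rewrite inE => /and3P[_ + _].
  by rewrite all_rcons => /andP[].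
(* Here [w] itself is lowered to [1]. *)
have ones : nseq (size y) 1 \in PAinv y.
  rewrite -[nseq _ _]cats0 sz0; apply: (PAinv_lower_min y1' (a := w)) => //.
  by rewrite cats1.
apply/PAinvP => x'; case/lastP: x' => [|x' b].
  by move/perm_size; rewrite size_rcons.
move=> x'p; have := x'p.
have : b \in rcons (nseq (size y) 1) w by rewrite -(perm_mem x'p) mem_rcons mem_head.
(* The last entry [b] is [w] or [1]; the rest rearranges [ones] or the vector of [wW],
   respectively. *)
rewrite mem_rcons inE mem_nseq => /predU1P[->|/andP[_ /eqP->]].
  rewrite perm_rcons perm_sym perm_rcons perm_sym perm_cons => x'1.
  by apply: PA_rcons => //; [lia | apply: (PAinvP _ _ ones)].
rewrite perm_rcons sz0 -[rcons (nseq _.+1 _) _]/(1 :: rcons _ _) perm_cons => x'w.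
by apply: PA_rcons => //; apply: (PAinvP _ _ wW).
Qed.

(** * Subset sums and the size of [W] *)

(* Once spot [w] is taken, each later block lies entirely to one side of it. *)
Lemma final_spots_subset_sum m w occ cars occ' : w \in occ ->
  final_spots m occ cars = Some occ' ->
  exists2 b : bitseq, size b = size cars &
    count (ltn^~ w) occ' = count (ltn^~ w) occ + sumn (mask b (unzip2 cars)).
Proof.
elim: cars occ => /= [|[p l] cars IH] occ w_occ; first by case=> <-; exists [::]; rewrite ?mask0 ?addn0.
case E: parking_start => [s|//] run.
have [|b sb ->] := IH _ _ run; first by rewrite mem_cat w_occ orbT.
have [_ /free_blockP[_ free] _] := (parking_startP _ _ _ _ _).1 E.
have w_new : ~~ (s <= w < s + l) by apply/negP => /free; rewrite w_occ.
(* The mask selects the cars whose blocks lie before [w]. *)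
exists ((s < w) :: b); first by rewrite /= sb.
rewrite count_cat -addnA addnCA; congr (_ + _).
have [sw|ws] := ltnP s w.
  rewrite /=; congr (_ + _).
  rewrite -[RHS](size_iota s) -count_predT; apply: eq_in_count => q.
  by rewrite mem_iota => qs /=; apply/idP; lia.
rewrite /= -[RHS]add0n; congr (_ + _); apply/eqP; rewrite -leqn0 leqNgt -has_count.
by apply/hasPn => q; rewrite mem_iota /=; lia.
Qed.

Lemma W_subset_sum y w : all (leq 1) y -> w \in W y ->
  exists b : (size y).-1.-tuple bool, w = (sumn (mask b (behead y))).+1.
Proof.
case: y => [|l y] y1; rewrite /W inE => inv.
  by have /PAP[] := PAinvP _ _ inv _ (perm_refl _).
have /(PAinvP _ _ inv)/PAP[szx x1 [occ run]] :
    perm_eq (w :: nseq (size y) 1) (rcons (nseq (size y) 1) w).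
  by rewrite perm_sym perm_rcons.
have full := final_spots_full szx x1 run.
have [//|u _] := final_spots_uniq run.
have /andP[l0 _] := y1; move: x1 run => /= /andP[w0 _].
case E: parking_start => [s|//].
have [ws /free_blockP[sl _] noblock] := (parking_startP _ _ _ _ _).1 E.
(* On the empty street a block fitting at [s >= w] also fits at [w], so the first car gets its
   preference. *)
have {E noblock ws sl} [<- wm] : w = s /\ w <= sumn (l :: y).
  split; last by move: ws => /= ; lia.
  apply/eqP; rewrite eqn_leq (proj1 (andP ws)) leqNgt /=; apply/negP => lt_ws.
  have /noblock/negP[] : w <= w < s by lia.
  by apply/free_blockP; split=> //; lia.
have w_occ : w \in iota w l ++ [::] by rewrite cats0 mem_iota; lia.
case/(final_spots_subset_sum w_occ) => b.
rewrite size_zip size_nseq minnn => /eqP sb.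
rewrite unzip2_zip ?size_nseq // cats0.
have -> : count (ltn^~ w) (iota w l) = 0.
  by apply/eqP; rewrite -leqn0 leqNgt -has_count; apply/hasPn => q; rewrite mem_iota /=; lia.
(* Splitting the full street at [w] leaves [w.-1] spots to its left. *)
have /permP-> : perm_eq occ (iota 1 w.-1 ++ iota w (sumn (l :: y) - w.-1)).
  apply: uniq_perm => // [|q].
    rewrite cat_uniq !iota_uniq andbT /=.
    by apply/hasPn => q; rewrite !mem_iota; lia.
  by rewrite full mem_cat !mem_iota; lia.
rewrite count_cat => countE; exists (Tuple sb); rewrite /= -[sumn _]add0n -countE.
have -> : count (ltn^~ w) (iota 1 w.-1) = w.-1.
  rewrite -[RHS](size_iota 1) -count_predT; apply: eq_in_count => q.
  by rewrite mem_iota => qs /=; apply/idP; lia.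
suff -> : count (ltn^~ w) (iota w (sumn (l :: y) - w.-1)) = 0 by lia.
by apply/eqP; rewrite -leqn0 leqNgt -has_count; apply/hasPn => q; rewrite mem_iota /=; lia.
Qed.

(** [W y] is a predicate on all naturals, so its size is measured by duplicate-free lists, each
    contained in the image of the masks. *)
Lemma size_W y s : all (leq 1) y -> uniq s -> {subset s <= W y} ->
  size s <= 2 ^ (size y).-1.
Proof.
move=> y1 us sW; rewrite -card_bool -card_tuple.
rewrite -(size_image (fun b : (size y).-1.-tuple bool => (sumn (mask b (behead y))).+1)).
apply: uniq_leq_size => // w /sW /(W_subset_sum y1)[b ->].
exact: image_f.
Qed.

(** * Nondecreasing invariant assortments and their number *)

(** Spot [1] ends up filled, which only a car preferring [1] can do; sorting puts such an entry
    first. *)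
Lemma PAinv_up_head y x : 0 < size y -> all (leq 1) y -> x \in PAinv_up y ->
  x = 1 :: behead x.
Proof.
move=> y0 y1; rewrite inE => /andP[inv srt].
have /PAP[szx x1 [occ run]] := PAinvP _ _ inv _ (perm_refl _).
have : 1 \in occ.
  rewrite (final_spots_full szx x1 run) /=.
  by case: (y) y0 y1 => //= l y' _ /andP[l0 _]; lia.
case/(final_spots_bounds run) => // _ [p]; rewrite unzip1_zip ?szx //.
case: x srt x1 {inv szx run} => //= a x /(order_path_min leq_trans)/allP ax.
case/andP=> a1 _; rewrite inE => /predU1P[->|/ax ap] p1; congr (_ :: _); lia.
Qed.

Lemma sorted_ones x : all (leq 1) x -> sorted leq x ->
  x = nseq (count_mem 1 x) 1 ++ [seq a <- x | a != 1].
Proof.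
elim: x => //= a x IH /andP[a1 x1] srt.
have [->|a_neq1] := eqVneq a 1.
  by rewrite add1n /= -IH //; apply: path_sorted srt.
have x_gt1 : all (leq 2) x.
  by apply: sub_all (order_path_min leq_trans srt) => b /=; lia.
have -> : count_mem 1 x = 0.
  apply/eqP; rewrite -leqn0 leqNgt -has_count; apply/hasPn => b /(allP x_gt1).
  by case: b => [|[|b]].
congr (_ :: _); symmetry; apply/all_filterP.
by apply: sub_all x_gt1 => b /=; lia.
Qed.

Lemma deg_le_chi y x : x \in PAinv y -> deg x <= chi y.
Proof.
move=> inv; have /PAP[szx x1 [occ run]] := PAinvP _ _ inv _ (perm_refl _).
have xm : {in x, forall p, p <= sumn y}.
  by have := final_spots_pref run; rewrite unzip1_zip ?szx.
have szv : size [seq inord p : 'I_(sumn y).+1 | p <- x] == size y.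
  by rewrite size_map szx.
(* [inord] loses nothing here, since every preference is at most [sumn y]. *)
have vE : vec_val (Tuple szv : vec y) = x.
  rewrite /vec_val /= -map_comp -[RHS]map_id; apply/eq_in_map => p /xm px /=.
  by rewrite inordK.
by rewrite -{1}vE; apply: leq_bigmax_cond; rewrite vE.
Qed.

Lemma chi_le_size y : chi y <= size y.
Proof.
apply/bigmax_leqP => v _.
by rewrite /deg (leq_trans (count_size _ _)) // size_map size_tuple.
Qed.

Lemma PAinv_up_split y x : all (leq 1) y -> x \in PAinv_up y ->
  exists w : (chi y).-tuple nat,
    all [pred a | a \in W y] w /\ x = nseq (size y - chi y) 1 ++ w.
Proof.
move=> y1; rewrite inE => /andP[inv srt].
have /PAP[szx x1 _] := PAinvP _ _ inv _ (perm_refl _).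
have chi_y := chi_le_size y.
have sw : size (drop (size y - chi y) x) == chi y by rewrite size_drop szx subKn.
exists (Tuple sw); split=> /=.
  by apply/allP => a /mem_drop a_x /=; apply: mem_W inv a_x.
rewrite -[LHS](cat_take_drop (size y - chi y)); congr (_ ++ _).
rewrite {1}(sorted_ones x1 srt) takel_cat ?size_nseq ?take_nseq //.
(* The number of ones is [size y - deg x], hence at least [size y - chi y]. *)
all: have := count_predC (pred1 1) x; have := deg_le_chi inv; rewrite /deg szx.
all: by rewrite -[count (predC _) x]/(count [pred a | a != 1] x); lia.
Qed.

(** After the leading [1], each entry is replaced by its rank in the increasing list [L] of members
    of [W y]. This injects the assortments into sorted tuples over ['I_K.+1], counted by
    [card_sorted_tuples]. *)
Lemma card_PAinv_up y : 0 < size y -> all (leq 1) y ->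
  #|PAinv_up_set y| <= 'C((size y).-1 + (2 ^ (size y).-1).-1, (size y).-1).
Proof.
move=> y0 y1; pose L := [seq a <- iota 0 (sumn y).+1 | a \in W y].
have L_srt : sorted ltn L.
  by apply: sorted_filter; [apply: ltn_trans | apply: iota_ltn_sorted].
have szL : size L <= 2 ^ (size y).-1.
  apply: size_W => // [|a]; first by rewrite filter_uniq ?iota_uniq.
  by rewrite mem_filter => /andP[].
set K := (2 ^ _).-1; have KE : 2 ^ (size y).-1 = K.+1 by rewrite prednK ?expn_gt0.
(* Ranks of members of [L] are below [2 ^ (size y).-1], so [inord] never falls back to its default
   on them. *)
have inordL a : a \in L -> @inord K (index a L) = index a L :> nat.
  by move=> aL; rewrite inordK // -KE (leq_trans _ szL) ?index_mem.
have mono : {in L &, {homo (fun a => index a L) : a b / a <= b}}.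
  move=> a b aL bL; apply: contraTT; rewrite -!ltnNge.
  exact: (sorted_ltn_index ltn_trans L_srt).
have memL v : v \in PAinv_up_set y -> {subset vec_val v <= L}.
  rewrite !inE => /andP[inv _] a av.
  rewrite mem_filter (mem_W y1 inv av) mem_iota /= add0n ltnS.
  by case/mapP: av => i _ ->; rewrite -ltnS ltn_ord.
pose g (v : vec y) : (size y).-1.-tuple 'I_K.+1 :=
  [tuple of [seq inord (index (val i) L) | i <- behead v]].
have gE v : [seq val i | i <- g v] =
    [seq val (@inord K (index a L)) | a <- behead (vec_val v)].
  by rewrite /= /vec_val behead_map -!map_comp.
have memL' v : v \in PAinv_up_set y -> {subset behead (vec_val v) <= L}.
  by move=> /memL vL a /mem_behead /vL.
(* Reading the ranks back through [nth] recovers [v], which gives injectivity of [g]. *)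
have gK v : v \in PAinv_up_set y ->
    vec_val v = 1 :: [seq nth 0 L (val i) | i <- g v].
  move=> vP; have := vP; rewrite inE => /(PAinv_up_head y0 y1) {1}->.
  rewrite [in RHS]map_comp gE -map_comp; congr (_ :: _).
  rewrite -[LHS]map_id; apply/eq_in_map => a /(memL' _ vP) aL /=.
  by rewrite inordL // nth_index.
rewrite -card_sorted_tuples -(card_in_imset (f := g)); last first.
  move=> v v' vP v'P gvv'; apply/val_inj/(inj_map val_inj).
  by rewrite -[LHS]/(vec_val v) gK // gvv' -gK.
apply/subset_leq_card/subsetP => _ /imsetP[v vP ->]; rewrite inE gE.
have srt : sorted leq (behead (vec_val v)).
  move: vP; rewrite !inE => /andP[_]; case: (vec_val v) => //= a s.
  exact: path_sorted.
apply: (homo_sorted_in (P := mem L)) srt; last by apply/allP/(memL' _ vP).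
by move=> a b aL bL ab /=; rewrite !inordL //; apply: mono.
Qed.

Theorem theorem6 (n : nat) (y : n.-tuple nat)
    (hn : 0 < n) (hy : forall i : 'I_n, 0 < tnth y i) :
  (forall x : seq nat, x \in PAinv_up y ->
     chi y <= n /\
     exists w : (chi y).-tuple nat,
       all [pred a | a \in W y] w /\ x = nseq (n - chi y) 1 ++ w) /\
  #|PAinv_up_set y| <= 'C(2 ^ (n - 1) + n - 2, n - 1).
Proof.
have y1 : all (leq 1) y by apply/allP => _ /tnthP[i ->].
split=> [x xP|].
  split; last by have := PAinv_up_split y1 xP; rewrite {1}size_tuple.
  by have := chi_le_size y; rewrite size_tuple.
have := @card_PAinv_up y; rewrite size_tuple => /(_ hn y1).
have := expn_gt0 2 n.-1; rewrite /= subn1.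
by have -> : n.-1 + (2 ^ n.-1).-1 = 2 ^ n.-1 + n - 2 by lia.
Qed.
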